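(* Let $p,q$ be real numbers with $0\le p\le 1$ and $q=1-p$. Then $$\begin{aligned}3H(p,q)={}&H(p^3+3pq^2,\;q^3+3qp^2)+(p^3+3pq^2)\,H\!\left(\frac{p^3}{p^3+3pq^2},\frac{3pq^2}{p^3+3pq^2}\right)\\&+(q^3+3qp^2)\,H\!\left(\frac{q^3}{q^3+3qp^2},\frac{3qp^2}{q^3+3qp^2}\right)+3pq\log 3,\end{aligned}$$ where a term whose prefactor ($p^3+3pq^2$ or $q^3+3qp^2$) is $0$ is interpreted as $0$.
   Context: All logarithms are to base $2$. For non-negative reals $u,v$ with $u+v=1$, $H(u,v)=u\log\frac1u+v\log\frac1v$ is the Shannon entropy function, with the convention $0\log\frac10=0$. *)

(* Defs.v *)
From Stdlib Require Import Reals.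
Local Open Scope R_scope.

Definition log2 (x : R) : R := Rlog 2 x.

(* Binary entropy in bits, meaningful for u, v >= 0 with u + v = 1.
   [Rinv] and [ln] are total, so a summand with u = 0 (or v = 0) equals
   0 * _ = 0, which is the convention 0 log (1/0) = 0. *)
Definition H (u v : R) : R := u * log2 (1 / u) + v * log2 (1 / v).

(* Main.v *)
Require Import Defs.
From Stdlib Require Import Reals Lra.
Local Open Scope R_scope.

(** The function [eta x = x log (1/x)] obeys the Leibniz rule
    [eta (x y) = x eta y + y eta x] on the non-negative reals, zero included.
    Applied to [a = s (a/s)] and [b = s (b/s)] with [s = a + b], it gives the
    grouping property [eta s + s H (a/s, b/s) = eta a + eta b], so the
    right-hand side is [eta p^3 + eta (3pq^2) + eta q^3 + eta (3qp^2) + 3pq log 3].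
    Expanding by the Leibniz rule leaves [3 (p+q)^2 (eta p + eta q)], the terms
    in [log 3] cancelling because [p + q = 1]. *)

Definition eta (x : R) : R := x * log2 (1 / x).

Lemma eta_0 : eta 0 = 0.
Proof. unfold eta; ring. Qed.

Lemma log2_inv (x : R) : 0 < x -> log2 (1 / x) = - log2 x.
Proof.
  intros Hx. unfold log2, Rlog, Rdiv.
  rewrite Rmult_1_l, ln_Rinv by assumption. ring.
Qed.

Lemma log2_mult (x y : R) : 0 < x -> 0 < y -> log2 (x * y) = log2 x + log2 y.
Proof.
  intros Hx Hy. unfold log2, Rlog, Rdiv.
  rewrite ln_mult by assumption. ring.
Qed.

Lemma eta_mult (x y : R) :
  0 <= x -> 0 <= y -> eta (x * y) = x * eta y + y * eta x.
Proof.
  (* If a factor is 0, both sides vanish; the logarithm law is applied only to positive factors. *)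
  intros [Hx | <-] [Hy | <-];
    rewrite ?Rmult_0_l, ?Rmult_0_r, ?eta_0; try ring.
  unfold eta.
  rewrite !log2_inv by auto using Rmult_lt_0_compat.
  rewrite log2_mult by assumption. ring.
Qed.

Lemma eta_sqr (x : R) : 0 <= x -> eta (x ^ 2) = 2 * x * eta x.
Proof.
  intros Hx. replace (x ^ 2) with (x * x) by ring.
  rewrite eta_mult by assumption. ring.
Qed.

Lemma eta_cube (x : R) : 0 <= x -> eta (x ^ 3) = 3 * x ^ 2 * eta x.
Proof.
  intros Hx. replace (x ^ 3) with (x * x ^ 2) by ring.
  rewrite eta_mult, eta_sqr by auto using pow_le. ring.
Qed.

Lemma entropy_grouping (a b : R) :
  0 <= a -> 0 <= b ->
  eta (a + b) + (a + b) * H (a / (a + b)) (b / (a + b)) = eta a + eta b.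
Proof.
  intros Ha Hb.
  destruct (Req_dec (a + b) 0) as [Hs | Hs].
  (* The factor [a + b = 0] cancels the entropy of the meaningless quotients. *)
  - replace a with 0 by lra. replace b with 0 by lra.
    rewrite Rplus_0_r, eta_0. ring.
  - assert (Hpos : 0 < a + b) by lra.
    assert (Hpart : forall c, 0 <= c ->
      eta c = (a + b) * eta (c / (a + b)) + c / (a + b) * eta (a + b)).
    { intros c Hc.
      rewrite <- eta_mult by (try apply Rle_mult_inv_pos; lra).
      f_equal. field. exact Hs. }
    rewrite (Hpart a Ha), (Hpart b Hb).
    change (H ?u ?v) with (eta u + eta v).
    field. exact Hs.
Qed.

(* A term whose prefactor is 0 is 0 * _ = 0, since division is total. *)
Theorem mainTheorem2 (p q : R) (hp : 0 <= p <= 1) (hq : q = 1 - p) :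
  3 * H p q =
    H (p ^ 3 + 3 * p * q ^ 2) (q ^ 3 + 3 * q * p ^ 2)
    + (p ^ 3 + 3 * p * q ^ 2)
      * H (p ^ 3 / (p ^ 3 + 3 * p * q ^ 2))
          (3 * p * q ^ 2 / (p ^ 3 + 3 * p * q ^ 2))
    + (q ^ 3 + 3 * q * p ^ 2)
      * H (q ^ 3 / (q ^ 3 + 3 * q * p ^ 2))
          (3 * q * p ^ 2 / (q ^ 3 + 3 * q * p ^ 2))
    + 3 * p * q * log2 3.
Proof.
  assert (Hq : 0 <= q) by lra. destruct hp as [Hp _].
  assert (Hmix : forall x y, 0 <= x -> 0 <= y ->
    eta (3 * x * y ^ 2)
    = 3 * y ^ 2 * eta x + 6 * x * y * eta y - 3 * x * y ^ 2 * log2 3).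
  { intros x y Hx Hy.
    rewrite !eta_mult, eta_sqr
      by (auto using pow_le; try apply Rmult_le_pos; lra).
    (* The third occurrence is [eta 3], equal to [- 3 * log2 3]. *)
    unfold eta at 3. rewrite (log2_inv 3) by lra. ring. }
  assert (Hpq : 0 <= 3 * p * q ^ 2)
    by (repeat apply Rmult_le_pos; auto using pow_le; lra).
  assert (Hqp : 0 <= 3 * q * p ^ 2)
    by (repeat apply Rmult_le_pos; auto using pow_le; lra).
  pose proof (entropy_grouping (p ^ 3) _ (pow_le _ _ Hp) Hpq) as Gp.
  pose proof (entropy_grouping (q ^ 3) _ (pow_le _ _ Hq) Hqp) as Gq.
  rewrite eta_cube, Hmix in Gp, Gq by assumption.
  change (H p q) with (eta p + eta q).
  change (H (p ^ 3 + 3 * p * q ^ 2) (q ^ 3 + 3 * q * p ^ 2))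
    with (eta (p ^ 3 + 3 * p * q ^ 2) + eta (q ^ 3 + 3 * q * p ^ 2)).
  (* With [p + q] left symbolic, the second equality is just the sum of [Gp] and [Gq]; the first
     puts [p + q = 1]. *)
  transitivity (3 * (p + q) ^ 2 * (eta p + eta q)
                + 3 * p * q * (1 - (p + q)) * log2 3).
  - replace (p + q) with 1 by lra. ring.
  - lra.
Qed.
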